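(* Let $a$ be a real number with $a^{2}<1$, and set $r_{1}=-a+i\sqrt{1-a^{2}}$ and $r_{2}=-a-i\sqrt{1-a^{2}}$, so that $x^{2}-2ax+1=(x+r_{1})(x+r_{2})$. Then $$\int_{0}^{1}\frac{\log x\,dx}{x^{2}-2ax+1}=\frac{1}{r_{2}-r_{1}}\left(\operatorname{Li}_{2}\left(-\frac{1}{r_{1}}\right)-\operatorname{Li}_{2}\left(-\frac{1}{r_{2}}\right)\right).$$
   Context: $\operatorname{Li}_{2}$ denotes the dilogarithm function (written $\text{PolyLog}[2,x]$ in the paper), defined by $\operatorname{Li}_{2}(z)=-\int_{0}^{z}\frac{\log(1-t)}{t}\,dt$, where for complex $z\notin[1,\infty)$ the integral is taken along the straight segment from $0$ to $z$ and $\log$ is the principal branch of the logarithm. For $|z|\le 1$ this equals $\sum_{k=1}^{\infty}\frac{z^{k}}{k^{2}}$. *)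

(* Defs.v *)
From Stdlib Require Import Reals Lra.
From Coquelicot Require Import Coquelicot.
Open Scope R_scope.

(* Principal argument, with values in (-PI, PI]; the value at 0 is
   meaningless. *)
Definition Carg (z : C) : R :=
  if Rle_dec 0 (Im z) then acos (Re z / Cmod z) else - acos (Re z / Cmod z).

Lemma Carg_spec (z : C) : z <> 0%C ->
  - PI < Carg z <= PI /\
  z = (Cmod z * cos (Carg z), Cmod z * sin (Carg z)).
Proof.
intros Hz.
pose proof (Cmod_gt_0 z) as [Hm _]; specialize (Hm Hz).
set (t := Re z / Cmod z).
pose proof (re_le_Cmod z) as Hre.
assert (Ht : -1 <= t <= 1).
{ apply Rabs_le_between in Hre. unfold t. split.
  - apply Rmult_le_reg_r with (Cmod z); [easy|]. field_simplify; lra.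
  - apply Rmult_le_reg_r with (Cmod z); [easy|]. field_simplify; lra. }
pose proof (acos_bound t) as Hb.
assert (Hc : Cmod z * t = Re z) by (unfold t; field; lra).
assert (Hs : Cmod z * sqrt (1 - Rsqr t) = Rabs (Im z)).
{ rewrite <- (sqrt_Rsqr (Cmod z)) by lra.
  rewrite <- sqrt_mult.
  - rewrite <- sqrt_Rsqr_abs. f_equal.
    pose proof (Cmod2_alt z) as H2. unfold Rsqr in *.
    replace (Cmod z * Cmod z * (1 - t * t))
      with (Cmod z ^ 2 - (Cmod z * t) * (Cmod z * t)) by ring.
    rewrite Hc, H2. ring.
  - apply Rle_0_sqr.
  - unfold Rsqr. nra. }
unfold Carg; fold t.
destruct (Rle_dec 0 (Im z)) as [Hi | Hi]; split.
- pose proof PI_RGT_0. lra.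
- rewrite cos_acos, sin_acos by easy. rewrite Hc, Hs, Rabs_pos_eq by easy.
  now destruct z.
- split; [|pose proof PI_RGT_0; lra].
  destruct (Rle_lt_or_eq_dec _ _ (proj2 Hb)) as [Hlt | Heq]; [lra|].
  exfalso. rewrite <- (sin_acos t) in Hs by easy.
  rewrite Heq, sin_PI, Rmult_0_r in Hs.
  symmetry in Hs. apply Rabs_eq_0 in Hs. lra.
- rewrite cos_neg, sin_neg, cos_acos, sin_acos by easy.
  rewrite Ropp_mult_distr_r_reverse, Hc, Hs, Rabs_left1 by lra.
  rewrite Ropp_involutive. now destruct z.
Qed.

(* Principal branch of the logarithm. *)
Definition Clog (z : C) : C := (ln (Cmod z), Carg z).

(* Integral of f along the straight segment from 0 to z, parametrised by
   t |-> t z on [0, 1]. *)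
Definition CInt_segment0 (f : C -> C) (z : C) : C :=
  RInt (V := C_R_CompleteNormedModule) (fun t : R => (f (t * z) * z)%C) 0 1.

(* Intended for z outside [1, +oo). The singularity of the integrand at 0 is
   removable, so the value given there by the division by 0 is irrelevant. *)
Definition Li2 (z : C) : C :=
  (- CInt_segment0 (fun t => Clog (1 - t) / t) z)%C.

(* Main.v *)
Require Import Defs.
From Stdlib Require Import Reals Lra.
From Coquelicot Require Import Coquelicot.
Open Scope R_scope.

(** Write w = a + i s with s = sqrt (1 - a^2), so that |w| = 1, -1/r1 = w and
    -1/r2 is the conjugate of w. For 0 <= t <= 1 the number 1 - t w has the
    positive real part 1 - t a, hence its principal argument is
    - atan (t s / (1 - t a)). Put h t = atan (t s / (1 - t a)). The segment
    integral defining the dilogarithm then gives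
    Im (Li2 w) = int_0^1 h t / t dt ([Li2_eq]), and conjugating w conjugates
    Li2 w ([Li2_conj]). As r2 - r1 = - 2 i s, the right-hand side of the theorem
    is - Im (Li2 w) / s.

    On the other side, h vanishes at 0 and its derivative is
    s / ((1 - t a)^2 + (t s)^2) = s / (t^2 - 2 a t + 1), precisely because
    a^2 + s^2 = 1. So integrating ln against h' by parts turns the logarithmic
    integral into - (1/s) int_0^1 h t / t dt ([is_RInt_gen_ln_parts]), the same
    number. *)

(** * The principal argument in the right half-plane *)

Lemma Carg_atan (x y : R) : 0 < x -> Carg (x, y) = atan (y / x).
Proof.
intros Hx.
assert (Hz : ((x, y) : C) <> 0%C) by (intros E; injection E; lra).
destruct (Carg_spec _ Hz) as [Hb E].
pose proof (proj1 (Cmod_gt_0 _) Hz) as Hm.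
set (th := Carg (x, y)) in *. set (m := Cmod (x, y)) in *.
injection E as Ex Ey.
assert (Hc : 0 < cos th) by nra.
assert (Hth : - (PI / 2) < th < PI / 2).
{ split; apply Rnot_le_lt; intros H.
  - assert (cos (- th) <= 0) by (apply cos_le_0; lra).
    rewrite cos_neg in *. lra.
  - assert (cos th <= 0) by (apply cos_le_0; lra). lra. }
rewrite <- (atan_tan th) by lra. f_equal.
unfold tan. rewrite Ex, Ey. field. lra.
Qed.

(** * Integrals of h x / x *)

(** The value d fills the gap at 0; with d the derivative of h at 0, this is the
    continuous extension of the difference quotient of h. *)
Definition slope0 (h : R -> R) (d t : R) : R := if Req_EM_T t 0 then d else h t / t.

Lemma slope0_neq (h : R -> R) (d t : R) : t <> 0 -> slope0 h d t = h t / t.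
Proof. unfold slope0; destruct (Req_EM_T t 0); tauto. Qed.

Lemma continuous_slope0_0 (h : R -> R) (d : R) :
  h 0 = 0 -> is_derive h 0 d -> continuous (slope0 h d) 0.
Proof.
intros H0 Hd.
apply is_derive_Reals in Hd.
apply continuity_pt_filterlim.
intros eps Heps.
destruct (Hd eps Heps) as [del Hdel].
exists del; split; [apply cond_pos|].
intros x [[_ Hx] Hdist].
simpl in *; unfold Rdist in *.
rewrite slope0_neq by auto.
unfold slope0; destruct (Req_EM_T 0 0); [|tauto].
rewrite Rminus_0_r in Hdist.
specialize (Hdel x (not_eq_sym Hx) Hdist).
rewrite Rplus_0_l, H0, Rminus_0_r in Hdel. exact Hdel.
Qed.

Lemma continuous_slope0_neq (h : R -> R) (d t : R) :
  t <> 0 -> continuous h t -> continuous (slope0 h d) t.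
Proof.
intros Ht Hh.
apply continuous_ext_loc with (fun s => h s * / s).
- assert (Hp : 0 < Rabs t) by now apply Rabs_pos_lt.
  exists (mkposreal _ Hp). intros s Hs.
  unfold ball in Hs; simpl in Hs; unfold AbsRing_ball, abs, minus, plus, opp in Hs; simpl in Hs.
  rewrite slope0_neq; [reflexivity|].
  intros ->. rewrite Rplus_0_l, Rabs_Ropp in Hs. lra.
- apply (continuous_mult h Rinv); [exact Hh|].
  now apply continuous_Rinv.
Qed.

Lemma continuous_slope0 (h : R -> R) (d t : R) :
  h 0 = 0 -> is_derive h 0 d -> continuous h t -> continuous (slope0 h d) t.
Proof.
intros H0 Hd Ht.
destruct (Req_EM_T t 0) as [-> | Hn].
- now apply continuous_slope0_0.
- now apply continuous_slope0_neq.
Qed.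

(** The singularity at 0 is removable: the integrand agrees on (0, 1) with the
    continuous function [slope0 h (dh 0)]. *)
Lemma ex_RInt_div_id (h dh : R -> R) :
  h 0 = 0 ->
  (forall x, 0 <= x <= 1 -> is_derive h x (dh x)) ->
  ex_RInt (fun x => h x / x) 0 1.
Proof.
intros H0 Hd.
apply ex_RInt_ext with (slope0 h (dh 0)).
- intros x Hx. rewrite Rmin_left, Rmax_right in Hx by lra.
  apply slope0_neq. lra.
- apply (ex_RInt_continuous (V := R_CompleteNormedModule)).
  intros x Hx. rewrite Rmin_left, Rmax_right in Hx by lra.
  apply continuous_slope0; [exact H0 | apply Hd; lra |].
  apply (ex_derive_continuous (V := R_NormedModule)).
  exists (dh x). now apply Hd.
Qed.

(** * Integration by parts against the logarithm *)

(** Substituting y = 1 / x turns x ln x into - ln y / y, and ln y / y -> 0 at infinity. *)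
Lemma filterlim_xlnx_0 : filterlim (fun x => x * ln x) (at_right 0) (locally 0).
Proof.
apply filterlim_ext_loc with (fun x => - (ln (/ x) / / x)).
- exists (mkposreal 1 Rlt_0_1). intros x _ Hx.
  rewrite ln_Rinv by exact Hx. field. lra.
- rewrite <- Ropp_0 at 2.
  apply filterlim_comp with (locally 0).
  + apply filterlim_comp with (f := Rinv) (g := fun y => ln y / y) (G := Rbar_locally p_infty).
    * apply filterlim_Rinv_0_right.
    * exact is_lim_div_ln_p.
  + apply (filterlim_opp 0).
Qed.

(** With K the integral of h t / t from 0, the function ln x * h x - K x is a
    primitive of ln x * dh x on (0, 1]. At 1 it equals - K 1, since ln 1 = 0. At 0
    it tends to 0, since h x is at most of order x there and x ln x tends to 0. *)
Lemma is_RInt_gen_ln_parts (h dh : R -> R) :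
  h 0 = 0 ->
  (forall x, 0 <= x <= 1 -> is_derive h x (dh x)) ->
  (forall x, 0 <= x <= 1 -> continuous dh x) ->
  is_RInt_gen (fun x => ln x * dh x) (at_right 0) (at_point 1)
    (- RInt (fun x => h x / x) 0 1).
Proof.
intros H0 Hd Hc.
assert (Hs : forall x, 0 <= x <= 1 -> continuous (slope0 h (dh 0)) x).
{ intros x Hx. apply continuous_slope0; [exact H0 | apply Hd; lra |].
  apply (ex_derive_continuous (V := R_NormedModule)).
  exists (dh x). now apply Hd. }
(* Extending by constants outside [0, 1] makes K differentiable at the
   endpoints too. *)
set (g := extension_C0 (V := R_NormedModule) (slope0 h (dh 0)) 0 1).
assert (Hg : forall x, continuous g x).
{ apply extension_C0_continuous; [simpl; lra|].
  intros x Hx0 Hx1. apply Hs. simpl in *. lra. }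
assert (Eg : forall x, 0 < x <= 1 -> g x = h x / x).
{ intros x Hx. unfold g.
  rewrite extension_C0_ext by (simpl; lra). apply slope0_neq. lra. }
set (K := fun x => RInt g 0 x).
assert (HK : forall x, is_derive K x (g x)).
{ intros x. apply (is_derive_RInt (V := R_NormedModule)) with (a := 0).
  - apply filter_forall. intros y. apply (RInt_correct g).
    apply (ex_RInt_continuous (V := R_CompleteNormedModule)); auto.
  - apply Hg. }
assert (K0 : K 0 = 0) by exact (RInt_point 0 g).
assert (K1 : K 1 = RInt (fun x => h x / x) 0 1).
{ apply RInt_ext. intros x Hx. rewrite Rmin_left, Rmax_right in Hx by lra.
  apply Eg. lra. }
set (H := fun x => ln x * h x - K x).
assert (H1 : H 1 = - RInt (fun x => h x / x) 0 1).
{ unfold H. rewrite ln_1, K1. ring. }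
assert (HH : forall x, 0 < x <= 1 -> is_derive H x (ln x * dh x)).
{ intros x Hx.
  replace (ln x * dh x) with ((/ x * h x + ln x * dh x) - g x)
    by (rewrite Eg by lra; field; lra).
  apply (is_derive_minus (V := R_NormedModule) (fun x => ln x * h x) K); [|apply HK].
  apply (is_derive_mult ln h);
    [apply is_derive_ln; lra | apply Hd; lra | intros; apply Rmult_comm]. }
assert (Hlim : filterlim H (at_right 0) (locally 0)).
(* ln x * h x = (x ln x) * (h x / x), and the second factor stays bounded. *)
{ apply filterlim_ext_loc with (fun x => x * ln x * slope0 h (dh 0) x - K x).
  - exists (mkposreal 1 Rlt_0_1). intros x _ Hx.
    unfold H. rewrite slope0_neq by lra. field. lra.
  - assert (E0 : 0 * slope0 h (dh 0) 0 + - K 0 = 0) by (rewrite K0; ring).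
    refine (eq_rect _ (fun l => filterlim _ (at_right 0) (locally l)) _ _ E0).
    apply (filterlim_comp_2 (G := locally (0 * slope0 h (dh 0) 0)) (H := locally (- K 0)))
     with (g := fun x => - K x) (h := Rplus).
    + apply (filterlim_comp_2 (G := locally 0) (H := locally (slope0 h (dh 0) 0))) with (h := Rmult).
      * exact filterlim_xlnx_0.
      * eapply filterlim_filter_le_1; [apply filter_le_within|]. apply Hs; lra.
      * apply (filterlim_mult (K := R_AbsRing)).
    + eapply filterlim_filter_le_1; [apply filter_le_within|].
      apply (continuous_opp K).
      apply (ex_derive_continuous (V := R_NormedModule)).
      exists (g 0). apply HK.
    + apply (filterlim_plus (V := R_NormedModule)). }
(* The integral from x to 1 is H 1 - H x, which converges to H 1. *)
intros P HP. rewrite <- H1 in HP.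
assert (Hlim1 : filterlim (fun x => H 1 - H x) (at_right 0) (locally (H 1))).
{ refine (eq_rect _ (fun l => filterlim _ (at_right 0) (locally l)) _ _ (Rminus_0_r (H 1))).
  apply filterlim_comp with (locally 0); [exact Hlim|].
  apply (continuous_minus (fun _ => H 1) (fun y => y) 0);
    [apply continuous_const | apply continuous_id]. }
apply Filter_prod with (fun x => 0 < x < 1 /\ P (H 1 - H x)) (fun y => y = 1).
- apply filter_and; [|exact (Hlim1 P HP)].
  exists (mkposreal 1 Rlt_0_1). intros x Hx Hx0. split; [exact Hx0|].
  unfold ball in Hx; simpl in Hx; unfold AbsRing_ball, abs, minus, plus, opp in Hx; simpl in Hx.
  apply Rabs_def2 in Hx. lra.
- reflexivity.
- intros x y [Hx HPx] ->. exists (H 1 - H x). split; [|exact HPx].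
  apply (is_RInt_derive (V := R_CompleteNormedModule) H); simpl;
    intros z Hz; rewrite Rmin_left, Rmax_right in Hz by lra.
  + apply HH. lra.
  + apply (continuous_mult ln dh); [|apply Hc; lra].
    apply (ex_derive_continuous (V := R_NormedModule)).
    exists (/ z). apply is_derive_ln. lra.
Qed.

(** * The dilogarithm at a point with real part below 1 *)

Lemma ln_sqrt_half (x : R) : 0 < x -> ln (sqrt x) = ln x / 2.
Proof.
intros Hx. pose proof (sqrt_lt_R0 x Hx).
rewrite <- (sqrt_sqrt x) at 2 by lra.
rewrite ln_mult by assumption. field.
Qed.

Lemma one_minus_mult_pos (u t : R) : u < 1 -> 0 <= t <= 1 -> 0 < 1 - t * u.
Proof.
intros Hu Ht. destruct (Req_dec t 0) as [-> | Hn]; [lra|].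
assert (0 < t * (1 - u)) by (apply Rmult_lt_0_compat; lra). lra.
Qed.

(** The function is minus the argument of 1 - t w for w = u + i v, and the
    denominator of its derivative is |1 - t w|^2. *)
Lemma is_derive_atan_div (u v t : R) : 0 < 1 - t * u ->
  is_derive (fun t => atan (t * v / (1 - t * u))) t
    (v / ((1 - t * u) ^ 2 + (t * v) ^ 2)).
Proof.
intros Ht.
assert (0 < (1 - t * u) ^ 2 + (t * v) ^ 2) by nra.
auto_derive; [lra | field; simpl in *; lra].
Qed.

Lemma ex_RInt_atan_div (u v : R) : u < 1 ->
  ex_RInt (fun t => atan (t * v / (1 - t * u)) / t) 0 1.
Proof.
intros Hu.
apply (ex_RInt_div_id (fun t => atan (t * v / (1 - t * u))))
  with (dh := fun t => v / ((1 - t * u) ^ 2 + (t * v) ^ 2)).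
- unfold Rdiv. rewrite !Rmult_0_l. apply atan_0.
- intros t Ht. now apply is_derive_atan_div, one_minus_mult_pos.
Qed.

(** The factor w of the path cancels against the denominator t w, which leaves
    - Clog (1 - t w) / t. Its components are - ln |1 - t w| / t and
    - Carg (1 - t w) / t; the argument is an arctangent because
    1 - t u > 0 along the whole segment. *)
Lemma Li2_eq (u v : R) : u < 1 -> ((u, v) : C) <> 0%C ->
  Li2 (u, v) =
    (- RInt (fun t => ln ((1 - t * u) ^ 2 + (t * v) ^ 2) / 2 / t) 0 1,
     RInt (fun t => atan (t * v / (1 - t * u)) / t) 0 1).
Proof.
intros Hu Hw.
assert (Hpos : forall t, 0 <= t <= 1 -> 0 < 1 - t * u) by (intros t Ht; now apply one_minus_mult_pos).
assert (Hsq : forall t, 0 <= t <= 1 -> 0 < (1 - t * u) ^ 2 + (t * v) ^ 2).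
{ intros t Ht. specialize (Hpos t Ht). nra. }
unfold Li2, CInt_segment0.
set (hr := fun t => ln ((1 - t * u) ^ 2 + (t * v) ^ 2) / 2).
set (hi := fun t => atan (t * v / (1 - t * u))).
assert (Hr : ex_RInt (fun t => hr t / t) 0 1).
{ apply ex_RInt_div_id with (fun t => (- u * (1 - t * u) + v * (t * v)) / ((1 - t * u) ^ 2 + (t * v) ^ 2)).
  - unfold hr. replace ((1 - 0 * u) ^ 2 + (0 * v) ^ 2) with 1 by ring.
    rewrite ln_1. field.
  - intros t Ht. specialize (Hsq t Ht). unfold hr. auto_derive; [exact Hsq | field; lra]. }
assert (Hi : ex_RInt (fun t => hi t / t) 0 1) by now apply ex_RInt_atan_div.
assert (E : RInt (V := C_R_CompleteNormedModule)
    (fun t : R => (Clog (1 - t * (u, v)) / (t * (u, v)) * (u, v))%C) 0 1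
  = (RInt (fun t => hr t / t) 0 1, - RInt (fun t => hi t / t) 0 1)).
{ apply is_RInt_unique.
  apply (is_RInt_ext (V := C_R_NormedModule)) with (fun t => (hr t / t, - (hi t / t))).
  - intros t Ht. rewrite Rmin_left, Rmax_right in Ht by lra.
    assert (Ht0 : RtoC t <> 0%C) by (intros Et; injection Et; lra).
    assert (Ec : forall c : C, (c / (t * (u, v)) * (u, v) = c / t)%C)
      by (intros c; now field).
    rewrite Ec.
    assert (Ew : (1 - t * (u, v))%C = (1 - t * u, - (t * v))).
    { apply injective_projections; simpl; ring. }
    rewrite Ew. unfold Clog. rewrite Carg_atan by (apply Hpos; lra).
    assert (El : ln (Cmod (1 - t * u, - (t * v))) = hr t).
    { unfold Cmod, hr; simpl fst; simpl snd.
      replace ((- (t * v)) ^ 2) with ((t * v) ^ 2) by ring.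
      apply ln_sqrt_half, Hsq. lra. }
    rewrite El.
    replace (- (t * v) / (1 - t * u)) with (- (t * v / (1 - t * u)))
      by (specialize (Hpos t); field; lra).
    rewrite atan_opp. fold (hi t).
    apply injective_projections; simpl; field; lra.
  - apply (is_RInt_fct_extend_pair (U := R_NormedModule) (V := R_NormedModule)); simpl.
    + apply (RInt_correct (fun t => hr t / t)), Hr.
    + apply (is_RInt_opp (V := R_NormedModule) (fun t => hi t / t)).
      apply (RInt_correct (fun t => hi t / t)), Hi. }
rewrite E. apply injective_projections; simpl; [reflexivity | apply Ropp_involutive].
Qed.

(** In [Li2_eq] the real part is even in the imaginary part v of w, and the
    imaginary part is odd in v. *)
Lemma Li2_conj (w : C) : Re w < 1 -> w <> 0%C -> Li2 (Cconj w) = Cconj (Li2 w).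
Proof.
destruct w as [u v]; simpl; intros Hu Hw.
assert (Hw' : Cconj (u, v) <> 0%C).
{ intros E. apply Hw. injection E as -> E.
  apply injective_projections; simpl; lra. }
unfold Cconj at 1 in Hw'; simpl in Hw'. unfold Cconj at 1; simpl.
rewrite !Li2_eq by assumption. unfold Cconj; cbn [fst snd].
f_equal.
- f_equal. apply RInt_ext. intros t _. now replace ((t * - v) ^ 2) with ((t * v) ^ 2) by ring.
- rewrite <- (RInt_opp (V := R_CompleteNormedModule) (fun t => atan (t * v / (1 - t * u)) / t)).
  + apply RInt_ext. intros t _.
    replace (t * - v / (1 - t * u)) with (- (t * v / (1 - t * u))) by (unfold Rdiv; ring).
    rewrite atan_opp. apply Ropp_mult_distr_l_reverse.
  + now apply ex_RInt_atan_div.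
Qed.

(** * The logarithmic integral *)

Theorem mainTheorem1 :
  forall a : R, a ^ 2 < 1 ->
  let r1 : C := (- a + Ci * sqrt (1 - a ^ 2))%C in
  let r2 : C := (- a - Ci * sqrt (1 - a ^ 2))%C in
  let f : R -> R := fun x => ln x / (x ^ 2 - 2 * a * x + 1) in
  (forall x : C, (x * x - 2 * a * x + 1 = (x + r1) * (x + r2))%C) /\
  ex_RInt_gen f (at_right 0) (at_point 1) /\
  RtoC (RInt_gen f (at_right 0) (at_point 1)) =
    (1 / (r2 - r1) * (Li2 (- (1 / r1)) - Li2 (- (1 / r2))))%C.
Proof.
intros a Ha r1 r2 f.
set (s := sqrt (1 - a ^ 2)) in *.
assert (Hs : 0 < s) by (apply sqrt_lt_R0; lra).
assert (Hs2 : s * s = 1 - a ^ 2) by (apply sqrt_sqrt; lra).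
assert (Ha1 : a < 1) by nra.
set (w := (a, s) : C).
assert (Hw : w <> 0%C) by (intros E; injection E; lra).
assert (Er1 : r1 = (- a, s)) by (apply injective_projections; simpl; ring).
assert (Er2 : r2 = (- a, - s)) by (apply injective_projections; simpl; ring).
assert (Er : (r1 * r2 = 1)%C).
{ rewrite Er1, Er2. apply injective_projections; simpl; nra. }
assert (Hr1 : r1 <> 0%C) by (rewrite Er1; intros E; injection E; lra).
assert (Hr2 : r2 <> 0%C) by (rewrite Er2; intros E; injection E; lra).
assert (Ew : (- (1 / r1) = w)%C).
{ transitivity (- r2)%C.
  - rewrite <- Er. now field.
  - rewrite Er2. apply injective_projections; simpl; ring. }
assert (Ew' : (- (1 / r2) = Cconj w)%C).
{ transitivity (- r1)%C.
  - rewrite <- Er. now field.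
  - rewrite Er1. apply injective_projections; simpl; ring. }
set (h := fun t => atan (t * s / (1 - t * a))).
set (I := RInt (fun t => h t / t) 0 1).
assert (Hq : forall x, 0 < x ^ 2 - 2 * a * x + 1).
{ intros x. pose proof (pow2_ge_0 (x - a)). nra. }
assert (Hint : is_RInt_gen f (at_right 0) (at_point 1) (- I / s)).
{ replace (- I / s) with (scal (/ s) (- I)) by (unfold scal; simpl; unfold mult; simpl; field; lra).
  apply is_RInt_gen_ext with (fun x => scal (/ s) (ln x * (s / (x ^ 2 - 2 * a * x + 1)))).
  - apply filter_forall. intros xy x _. unfold f, scal; simpl; unfold mult; simpl.
    specialize (Hq x). field. simpl in *; lra.
  - apply (is_RInt_gen_scal (V := R_NormedModule)).
    apply (is_RInt_gen_ln_parts h).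
    + unfold h, Rdiv. rewrite !Rmult_0_l. apply atan_0.
    + intros t Ht.
      (* This is where a ^ 2 + s ^ 2 = 1 enters. *)
      replace (t ^ 2 - 2 * a * t + 1) with ((1 - t * a) ^ 2 + (t * s) ^ 2)
        by (replace ((t * s) ^ 2) with (t ^ 2 * (s * s)) by ring; rewrite Hs2; ring).
      now apply is_derive_atan_div, one_minus_mult_pos.
    + intros t _. specialize (Hq t).
      apply (ex_derive_continuous (V := R_NormedModule)).
      auto_derive. simpl in *; lra. }
split; [|split].
- intros x.
  transitivity (x * x + (r1 + r2) * x + r1 * r2)%C; [|ring].
  rewrite Er. f_equal. unfold Cminus. f_equal. rewrite Er1, Er2.
  apply injective_projections; simpl; ring.
- eexists; exact Hint.
- rewrite (is_RInt_gen_unique (V := R_CompleteNormedModule) f _ Hint).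
  rewrite Ew, Ew', Li2_conj by assumption.
  unfold w; rewrite Li2_eq by assumption.
  fold h. fold I.
  assert (Er21 : (r2 - r1)%C = (0, - 2 * s)).
  { rewrite Er1, Er2. apply injective_projections; simpl; ring. }
  rewrite Er21.
  assert (E : forall x y : R,
    (1 / (0, - 2 * s)%R * ((x, y) - Cconj (x, y)) = RtoC (- y / s))%C).
  { intros x y. apply injective_projections; simpl; field; lra. }
  symmetry. apply E.
Qed.
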